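(* Let $0<\beta<\alpha\le\pi$, let $f:\mathbb{R}\to\mathbb{R}$ be locally Lipschitz, and let $u$ be a solution of the mixed boundary value problem in the sub-spherical sector $\Sigma$ stated in the context. Let $\Lambda\in(0,\lambda_C)$. Suppose that $$u_{x_1}\sin(\vartheta-\tfrac\beta2)-u_{x_2}\cos(\vartheta-\tfrac\beta2)<0\ \text{ on }T_{\lambda,\vartheta}\cap\Sigma$$ for every $\lambda\ge\Lambda$ and every $\vartheta\in J_\lambda\cap(0,\vartheta_B(\lambda)]$. Then $$u_{x_1}\sin(\vartheta-\tfrac\beta2)-u_{x_2}\cos(\vartheta-\tfrac\beta2)<0\ \text{ on }T_{\lambda,\vartheta}\cap\Sigma_{\Lambda,\vartheta_A(\Lambda)}$$ for every $\lambda\in(\Lambda,\lambda_C)$ and every $\vartheta\in(\vartheta_A(\lambda),\vartheta_B(\lambda))$, where $\Sigma_{\Lambda,\vartheta_A(\Lambda)}$ is the right cap cut out from $\Sigma$ by the line $T_{\Lambda,\vartheta_A(\Lambda)}$.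
   Context: Geometry (vertex at the origin). For $0<\beta<\alpha\le\pi$ put $a=-\sin\frac{\alpha-\beta}{2}/\sin\frac\beta2<0$, $V=(0,0)$, $O=(-a,0)$, $P_\pm=(\cos\frac\alpha2-a,\pm\sin\frac\alpha2)$, $\Sigma=\{(x_1,x_2): |x_2|\cot\frac\beta2<x_1<\sqrt{1-x_2^2}-a\}$, $\Gamma_D=\{(\cos\theta-a,\sin\theta):|\theta|\le\alpha/2\}$, $\Gamma_N=\partial\Sigma\setminus\Gamma_D$; $l_N=\sin\frac\alpha2/\sin\frac\beta2$ is the length of each of the two segments forming $\Gamma_N$. Problem: $\Delta u+f(u)=0$ and $u>0$ in $\Sigma$, $\partial u/\partial\nu=0$ on $\Gamma_N$ ($\nu$ outward unit normal, away from $V$), $u=0$ on $\Gamma_D$. Solutions are classical, $u\in C^2(\Sigma)\cap C(\overline\Sigma)\cap C^1(\Sigma\cup\Gamma_N)$, and by standard regularity $u\in C(\overline\Sigma)\cap C^2(\overline\Sigma\setminus\{V,P_\pm\})$ throughout. Lines. For $\lambda>0$ let $x_{1\lambda}=\lambda\cos\frac\beta2$, $x_{2\lambda}=-\lambda\sin\frac\beta2$, $P_\lambda=(x_{1\lambda},x_{2\lambda})$, and $T_{\lambda,\vartheta}=\{x:(x_1-x_{1\lambda})\sin(\vartheta-\frac\beta2)-(x_2-x_{2\lambda})\cos(\vartheta-\frac\beta2)=0\}$. The right cap is $\Sigma_{\lambda,\vartheta}=\{x\in\Sigma:(x_1-x_{1\lambda})\sin(\vartheta-\frac\beta2)-(x_2-x_{2\lambda})\cos(\vartheta-\frac\beta2)>0\}$.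 Angles (with $\operatorname{arccot}$ taking values in $(0,\pi)$): $\vartheta_A(\lambda)=\operatorname{arccot}\frac{|a|\cos(\beta/2)-\lambda}{|a|\sin(\beta/2)}$ (for which $T_{\lambda,\vartheta}\ni O$), $\vartheta_B(\lambda)=\operatorname{arccot}\frac{l_N\cos\beta-\lambda}{l_N\sin\beta}$ (for which $T_{\lambda,\vartheta}\ni P_+$), $\lambda_C=|a|\sin\frac\alpha2/\sin\frac{\alpha+\beta}2$. $J_\lambda=(0,\frac{\pi+\beta}2]$ if $\lambda\ge\lambda_C$, and $J_\lambda=(0,\vartheta_A(\lambda)]\cup[\vartheta_B(\lambda),\frac{\pi+\beta}2]$ if $0<\lambda<\lambda_C$. *)

(* Defs.v *)
From HB Require Import structures.
From mathcomp Require Import all_boot all_order all_algebra.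
From mathcomp Require Import all_classical all_reals all_analysis.
Set Implicit Arguments.
Unset Strict Implicit.
Unset Printing Implicit Defensive.
Import Order.TTheory GRing.Theory Num.Theory.
Import numFieldNormedType.Exports.
Local Open Scope classical_set_scope.
Local Open Scope ring_scope.

Section Geometry.
Context {R : realType}.
Implicit Types (alpha beta lambda theta x : R) (A : set (R * R)).

Definition cot x : R := cos x / sin x.

(* The branch of arccot with values in ]0, pi[. *)
Definition arccot x : R := pi / 2 - atan x.

Definition boundary A : set (R * R) := closure A `\` interior A.

Definition sec_a alpha beta : R :=
  - (sin ((alpha - beta) / 2) / sin (beta / 2)).

Definition vertexV : R * R := (0, 0).

(* The conjunct `|p.2| <= 1 spells out the domain of the square root, which
   [Num.sqrt] would otherwise extend by 0. *)
Definition Sector alpha beta : set (R * R) :=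
  [set p | [/\ `|p.2| <= 1,
               `|p.2| * cot (beta / 2) < p.1 &
               p.1 < Num.sqrt (1 - p.2 ^+ 2) - sec_a alpha beta]].

Definition GammaD alpha beta : set (R * R) :=
  [set p | exists2 theta, `|theta| <= alpha / 2 &
           p = (cos theta - sec_a alpha beta, sin theta)].

Definition GammaN alpha beta : set (R * R) :=
  boundary (Sector alpha beta) `\` GammaD alpha beta.

(* Outward unit normal on [GammaN] minus the vertex, which consists of two
   segments on the half-lines p.2 = +- p.1 * tan (beta / 2), p.1 > 0. *)
Definition normalN beta (p : R * R) : R * R :=
  (- sin (beta / 2), if 0 < p.2 then cos (beta / 2) else - cos (beta / 2)).

Definition lN alpha beta : R := sin (alpha / 2) / sin (beta / 2).

Definition Ppt beta lambda : R * R :=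
  (lambda * cos (beta / 2), - (lambda * sin (beta / 2))).

Definition line_form beta lambda theta (p : R * R) : R :=
  (p.1 - (Ppt beta lambda).1) * sin (theta - beta / 2)
  - (p.2 - (Ppt beta lambda).2) * cos (theta - beta / 2).

Definition Tline beta lambda theta : set (R * R) :=
  [set p | line_form beta lambda theta p = 0].

Definition right_cap alpha beta lambda theta : set (R * R) :=
  Sector alpha beta `&` [set p | 0 < line_form beta lambda theta p].

Definition thetaA alpha beta lambda : R :=
  arccot ((`|sec_a alpha beta| * cos (beta / 2) - lambda)
          / (`|sec_a alpha beta| * sin (beta / 2))).

Definition thetaB alpha beta lambda : R :=
  arccot ((lN alpha beta * cos beta - lambda) / (lN alpha beta * sin beta)).

Definition lambdaC alpha beta : R :=
  `|sec_a alpha beta| * sin (alpha / 2) / sin ((alpha + beta) / 2).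

Definition J alpha beta lambda : set R :=
  if lambdaC alpha beta <= lambda then `]0, (pi + beta) / 2]%classic
  else `]0, thetaA alpha beta lambda]
       `|` `[thetaB alpha beta lambda, (pi + beta) / 2].

End Geometry.

Section Regularity.
Context {R : realType}.
Implicit Types (u g : R * R -> R) (D S : set (R * R)).

Definition dx1 u : R * R -> R := 'D_((1, 0) : R * R) u.
Definition dx2 u : R * R -> R := 'D_((0, 1) : R * R) u.

(* [D] is meant to be open. *)
Definition C1_on D u : Prop :=
  forall p, D p ->
    [/\ derivable u p ((1, 0) : R * R), derivable u p ((0, 1) : R * R),
        {for p, continuous (dx1 u)} & {for p, continuous (dx2 u)}].

Definition C2_on D u : Prop := [/\ C1_on D u, C1_on D (dx1 u) & C1_on D (dx2 u)].

(* [u] is C^1 on the open set [D] and its gradient extends continuously, as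
   (g1, g2), to [S], with D `<=` S `<=` closure D. Then (g1, g2) is uniquely
   determined on [S]. *)
Definition C1_extension D S u g1 g2 : Prop :=
  [/\ C1_on D u, (forall p, D p -> g1 p = dx1 u p /\ g2 p = dx2 u p),
      {within S, continuous g1} & {within S, continuous g2}].

Definition locally_lipschitz (f : R -> R) : Prop :=
  forall x : R, exists2 U : set R, nbhs x U & [lipschitz f y | y in U].

End Regularity.

(* Only the values of [u] on the closure of the sector are relevant; the
   Neumann condition uses the continuous extension of the gradient to
   [GammaN]. *)
Definition is_solution (R : realType) (alpha beta : R) (f : R -> R)
    (u : R * R -> R) : Prop :=
  let Sigma := Sector alpha beta in
  [/\ C2_on Sigma u,
      {within closure Sigma, continuous u},
      (forall p, Sigma p -> dx1 (dx1 u) p + dx2 (dx2 u) p + f (u p) = 0 /\ 0 < u p),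
      (exists g1 g2 : R * R -> R,
         C1_extension Sigma (Sigma `|` GammaN alpha beta) u g1 g2 /\
         forall p, GammaN alpha beta p -> p <> vertexV ->
           g1 p * (normalN beta p).1 + g2 p * (normalN beta p).2 = 0) &
      (forall p, GammaD alpha beta p -> u p = 0)].

(* Derivative of [u] along the unit normal of [Tline beta lambda theta] that
   points into the right cap. *)
Definition normal_deriv (R : realType) (beta theta : R) (u : R * R -> R)
    (p : R * R) : R :=
  dx1 u p * sin (theta - beta / 2) - dx2 u p * cos (theta - beta / 2).

(* Main.v *)
Require Import Defs.
From HB Require Import structures.
From mathcomp Require Import all_boot all_order all_algebra.
From mathcomp Require Import all_classical all_reals all_analysis.
From mathcomp Require Import ring lra.
Set Implicit Arguments.
Unset Strict Implicit.
Unset Printing Implicit Defensive.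
Import Order.TTheory GRing.Theory Num.Theory.
Import numFieldNormedType.Exports.
Local Open Scope classical_set_scope.
Local Open Scope ring_scope.

(** At a fixed point [p] the quantity [normal_deriv beta theta u p] is the
    scalar product of the gradient of [u] with a unit vector that turns with
    [theta].  If it is negative for two angles less than [pi] apart, then it is
    negative for every angle in between, because the vector in between is a
    positive combination of the other two ([normal_deriv_between]).

    So it suffices to find, among the lines through [p], two lines
    [T_{lambda1,theta1}] and [T_{lambda2,theta2}] covered by the hypothesis with
    [theta1 < theta < theta2].  These are the line joining [p] to the centre
    [O], with [theta1 = thetaA lambda1], and the line joining [p] to the corner
    [P_+], with [theta2 = thetaB lambda2].  What has to be shown is that they
    meet the lower side of the sector at parameters with
    [Lambda < lambda1 < lambda < lambda2 < lambdaC].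

    In coordinates adapted to the lower side this is affine algebra.  The sign
    of [side x y m X Y] tells on which side of the line from [(m, 0)] to
    [(x, y)] the point [(X, Y)] lies, and it is an affine function of [m]; so
    the line from [(x, y)] through [(X, Y)] has its foot strictly between two
    parameters at which the sign changes ([side_root]).  Seen from [O], the
    point [p] is right of the line with foot [Lambda] (it lies in the cap) and
    left of the one with foot [lambda] (as [thetaA lambda < theta]), whence
    [lambda1].  Being then also left of the line with foot [lambdaC], which
    contains both [O] and [P_+], and right of the line from [P_+] with foot
    [lambda] (as [theta < thetaB lambda]), it yields [lambda2]. *)

(** * The inverse cotangent *)

Lemma arccot_gt0 (R : realType) (x : R) : 0 < arccot x.
Proof. by rewrite subr_gt0 atan_ltpi2. Qed.

Lemma arccot_ltpi (R : realType) (x : R) : arccot x < pi.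
Proof. by rewrite /arccot; have := atan_gtNpi2 x; lra. Qed.

Lemma sin_arccot_gt0 (R : realType) (x : R) : 0 < sin (arccot x).
Proof. by apply: sin_gt0_pi; rewrite arccot_gt0 arccot_ltpi. Qed.

Lemma cos_arccot (R : realType) (x : R) :
  cos (arccot x) = x * sin (arccot x).
Proof.
have c_gt0 : 0 < cos (atan x).
  by apply: cos_gt0_pihalf; rewrite atan_gtNpi2 atan_ltpi2.
rewrite /arccot cosB sinB cos_pihalf sin_pihalf.
rewrite !mul0r !mul1r add0r subr0 -[X in X * _]atanK /tan divfK //.
by rewrite gt_eqF.
Qed.

Lemma le_arccot (R : realType) (x y : R) : x <= y -> arccot y <= arccot x.
Proof.
move=> xy; rewrite lerD2l lerN2 leNgt; apply/negP.
have atanI (z : R) : atan z \in `](- (pi / 2)), (pi / 2)[.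
  by rewrite in_itv /= atan_gtNpi2 atan_ltpi2.
by rewrite -(ltr_tan (atanI y) (atanI x)) !atanK ltNge xy.
Qed.

Lemma arccotNtan (R : realType) (x : R) : - (pi / 2) < x < pi / 2 ->
  arccot (- tan x) = pi / 2 + x.
Proof.
by move=> xI; rewrite /arccot -atanN opprK tanK // in_itv.
Qed.

(** * Coordinates along the lower side of the sector *)

(** The rotation by [beta / 2] about the vertex takes the point [Ppt beta m] to
    [(m, 0)]. *)
Definition along (R : realType) (beta : R) (p : R * R) : R :=
  p.1 * cos (beta / 2) - p.2 * sin (beta / 2).

Definition height (R : realType) (beta : R) (p : R * R) : R :=
  p.1 * sin (beta / 2) + p.2 * cos (beta / 2).

(** The determinant of [(X - m, Y)] and [(x - m, y)]. *)
Definition side (R : realType) (x y m X Y : R) : R :=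
  (X - m) * y - (x - m) * Y.

Lemma line_formE (R : realType) (beta m theta : R) (p : R * R) :
  line_form beta m theta p =
  (along beta p - m) * sin theta - height beta p * cos theta.
Proof.
rewrite /line_form /Ppt /along /height /= sinB cosB.
have := cos2Dsin2 (beta / 2); set c := cos (beta / 2); set s := sin (beta / 2).
move=> cs; rewrite -[X in _ = (_ - X) * _ - _]mulr1 -cs; ring.
Qed.

Lemma line_form_arccot (R : realType) (beta m x y : R) (p : R * R) : 0 < y ->
  line_form beta m (arccot ((x - m) / y)) p * y =
  sin (arccot ((x - m) / y)) * side x y m (along beta p) (height beta p).
Proof.
move=> y_gt0; rewrite line_formE cos_arccot /side.
by field; rewrite gt_eqF.
Qed.

Lemma line_form_arccot_gt0 (R : realType) (beta m x y : R) (p : R * R) :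
  0 < y -> (0 < line_form beta m (arccot ((x - m) / y)) p) =
           (0 < side x y m (along beta p) (height beta p)).
Proof.
move=> y_gt0; rewrite -(pmulr_lgt0 _ y_gt0) line_form_arccot //.
by rewrite pmulr_rgt0 // sin_arccot_gt0.
Qed.

Lemma line_form_arccot_lt0 (R : realType) (beta m x y : R) (p : R * R) :
  0 < y -> (line_form beta m (arccot ((x - m) / y)) p < 0) =
           (side x y m (along beta p) (height beta p) < 0).
Proof.
move=> y_gt0; rewrite -(pmulr_llt0 _ y_gt0) line_form_arccot //.
by rewrite pmulr_rlt0 // sin_arccot_gt0.
Qed.

Lemma Tline_arccot (R : realType) (beta m x y : R) (p : R * R) :
  0 < y -> side x y m (along beta p) (height beta p) = 0 ->
  Tline beta m (arccot ((x - m) / y)) p.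
Proof.
move=> y_gt0 side0; apply/eqP.
by rewrite -(mulIr_eq0 _ (mulIf (lt0r_neq0 y_gt0))) line_form_arccot // side0 mulr0.
Qed.

(** [side] is affine in [m], and the two signs force its slope [Y - y] to be
    negative; so the root is found by division, without continuity. *)
Lemma side_root (R : realType) (x y m1 m2 X Y : R) : m1 < m2 ->
  0 < side x y m1 X Y -> side x y m2 X Y < 0 ->
  exists2 m, m1 < m < m2 & side x y m X Y = 0.
Proof.
rewrite /side => m12 pos neg.
have slope_gt0 : 0 < y - Y by rewrite -(pmulr_rgt0 _ (_ : 0 < m2 - m1)); lra.
exists ((X * y - x * Y) / (y - Y)).
  by rewrite ltr_pdivlMr // ltr_pdivrMr //; apply/andP; split; lra.
by field; rewrite gt_eqF.
Qed.

(** Turning a line through [p] about its foot moves it off [p] to the side given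
    by the sign of [sin (t' - t)].  This turns an inequality between [theta] and
    [thetaA] or [thetaB] into the position of [p] relative to the line from the
    same foot to the centre or to [P_+]. *)
Lemma line_form_same_foot (R : realType) (beta m t t' : R) (p : R * R) :
  Tline beta m t p ->
  line_form beta m t' p * sin t = height beta p * sin (t' - t).
Proof.
rewrite /Tline /= !line_formE sinB => /eqP; rewrite subr_eq0 => /eqP Tt.
rewrite mulrBl [_ * sin t' * _]mulrAC Tt; ring.
Qed.

(** Since [p] lies on the second line, its signed distance to the line of the
    same angle through the first foot is the distance between the feet times
    [sin t'].  The comparison of angles at the first foot then decides. *)
Lemma sin_angle_gt0 (R : realType) (beta m t m' t' : R) (p : R * R) :
  Tline beta m t p -> Tline beta m' t' p -> 0 < height beta p ->
  0 < sin t -> 0 < sin t' -> m < m' -> 0 < sin (t' - t).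
Proof.
move=> Tt Tt' Y_gt0 st st' mm'; rewrite -(pmulr_rgt0 _ Y_gt0).
rewrite -(line_form_same_foot _ Tt) pmulr_lgt0 //.
have -> : line_form beta m t' p = (m' - m) * sin t'.
  move: Tt'; rewrite /Tline /= !line_formE; lra.
by rewrite mulr_gt0 ?subr_gt0.
Qed.

(** * Turning the direction of differentiation *)

(** By the addition formula, [sin (t2 - t1)] times the normal at angle [t] is
    [sin (t2 - t)] times the normal at [t1] plus [sin (t - t1)] times the normal
    at [t2]. *)
Lemma normal_deriv_between (R : realType) (beta t1 t t2 : R) u (p : R * R) :
  0 < sin (t - t1) -> 0 < sin (t2 - t) -> 0 < sin (t2 - t1) ->
  normal_deriv beta t1 u p < 0 -> normal_deriv beta t2 u p < 0 ->
  normal_deriv beta t u p < 0.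
Proof.
move=> s1 s2 s12 D1 D2; rewrite -(pmulr_rlt0 _ s12).
have -> : sin (t2 - t1) * normal_deriv beta t u p =
    sin (t2 - t) * normal_deriv beta t1 u p +
    sin (t - t1) * normal_deriv beta t2 u p.
  rewrite /normal_deriv.
  have -> : t2 - t1 = (t2 - beta / 2) - (t1 - beta / 2) by ring.
  have -> : t2 - t = (t2 - beta / 2) - (t - beta / 2) by ring.
  have -> : t - t1 = (t - beta / 2) - (t1 - beta / 2) by ring.
  move: (t2 - beta / 2) (t1 - beta / 2) (t - beta / 2) => x2 x1 x.
  rewrite !sinB; ring.
rewrite -(pmulr_rlt0 _ s2) in D1; rewrite -(pmulr_rlt0 _ s1) in D2; lra.
Qed.

(** * The geometry of the sector *)

Lemma height_gt0 (R : realType) (alpha beta : R) (p : R * R) :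
  0 < beta < pi -> Sector alpha beta p -> 0 < height beta p.
Proof.
move=> b_itv [_ p_gt _].
have s_gt0 : 0 < sin (beta / 2) by apply: sin_gt0_pihalf; lra.
have c_gt0 : 0 < cos (beta / 2) by apply: cos_gt0_pihalf; lra.
move: p_gt; rewrite /cot mulrA ltr_pdivrMr // /height.
have : - p.2 * cos (beta / 2) <= `|p.2| * cos (beta / 2).
  by rewrite ler_pM2r // lerNl lerNnormlW.
lra.
Qed.

Lemma norm_sec_a (R : realType) (alpha beta : R) :
  0 < beta -> beta < alpha -> alpha <= pi ->
  `|sec_a alpha beta| = sin ((alpha - beta) / 2) / sin (beta / 2).
Proof.
move=> b_gt0 ba a_pi; rewrite /sec_a normrN ger0_norm // divr_ge0 // ltW //.
  by apply: sin_gt0_pi; lra.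
by apply: sin_gt0_pi; lra.
Qed.

(** The line from [Ppt beta m] to [P_+] passes through the centre exactly when
    [m = lambdaC]. *)
Lemma side_corner_centre (R : realType) (alpha beta m : R) :
  0 < beta -> beta < alpha -> alpha <= pi ->
  side (lN alpha beta * cos beta) (lN alpha beta * sin beta) m
    (`|sec_a alpha beta| * cos (beta / 2)) (`|sec_a alpha beta| * sin (beta / 2))
  = (lambdaC alpha beta - m) * sin ((alpha + beta) / 2).
Proof.
move=> b_gt0 ba a_pi; rewrite /side /lambdaC norm_sec_a // /lN.
have s_gt0 : 0 < sin (beta / 2) by apply: sin_gt0_pi; lra.
have := cos2Dsin2 (beta / 2).
have sD_gt0 : 0 < sin ((alpha + beta) / 2) by apply: sin_gt0_pi; lra.
move: sD_gt0.
have -> : cos beta = cos (beta / 2 + beta / 2) by rewrite -splitr.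
have -> : sin beta = sin (beta / 2 + beta / 2) by rewrite -splitr.
have -> : (alpha + beta) / 2 = alpha / 2 + beta / 2 by ring.
have -> : (alpha - beta) / 2 = alpha / 2 - beta / 2 by ring.
rewrite sinB cosD !sinD.
move: (sin (beta / 2)) (cos (beta / 2)) (sin (alpha / 2)) (cos (alpha / 2)) s_gt0.
move=> s c sa ca s_gt0 sD_gt0 /eqP; rewrite -subr_eq0 => /eqP cs.
apply/eqP; rewrite -subr_eq0; apply/eqP.
transitivity ((c ^+ 2 + s ^+ 2 - 1) * (sa * (sa * c - ca * s) / s)); last first.
  by rewrite cs mul0r.
by field; rewrite !gt_eqF.
Qed.

(** The foot [lambdaC] of the line through the centre and [P_+] lies on the lower
    side of the sector, since that line leans to the right of the vertical when
    [alpha / 2] is at most [pi / 2]. *)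
Lemma lambdaC_le_lN (R : realType) (alpha beta : R) :
  0 < beta -> beta < alpha -> alpha <= pi -> lambdaC alpha beta <= lN alpha beta.
Proof.
move=> b_gt0 ba a_pi; rewrite /lambdaC norm_sec_a // /lN.
have s_gt0 : 0 < sin (beta / 2) by apply: sin_gt0_pi; lra.
have sa_gt0 : 0 < sin (alpha / 2) by apply: sin_gt0_pi; lra.
have sD_gt0 : 0 < sin ((alpha + beta) / 2) by apply: sin_gt0_pi; lra.
rewrite ler_pdivrMr // mulrAC [leRHS]mulrAC ler_pM2r ?invr_gt0 //.
rewrite mulrC ler_pM2l //.
have -> : (alpha + beta) / 2 = alpha / 2 + beta / 2 by ring.
have -> : (alpha - beta) / 2 = alpha / 2 - beta / 2 by ring.
rewrite sinB sinD.
have ca_ge0 : 0 <= cos (alpha / 2) by apply: cos_ge0_pihalf; lra.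
by have := mulr_ge0 ca_ge0 (ltW s_gt0); lra.
Qed.

(** The angle [(pi + beta) / 2] belongs to the vertical line, and the vertical
    line through [P_+] has foot [P_-], whose parameter is [lN]. *)
Lemma thetaB_le (R : realType) (alpha beta m : R) :
  0 < beta < pi -> 0 < lN alpha beta -> m <= lN alpha beta ->
  thetaB alpha beta m <= (pi + beta) / 2.
Proof.
move=> b_itv l_gt0 ml; rewrite mulrDl -arccotNtan; last by lra.
apply: le_arccot.
have s_gt0 : 0 < sin (beta / 2) by apply: sin_gt0_pihalf; lra.
have c_gt0 : 0 < cos (beta / 2) by apply: cos_gt0_pihalf; lra.
have sb_gt0 : 0 < sin beta by apply: sin_gt0_pi.
rewrite ler_pdivlMr; last exact: mulr_gt0.
suff -> : - tan (beta / 2) * (lN alpha beta * sin beta) =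
    lN alpha beta * cos beta - lN alpha beta by rewrite lerD2l lerN2.
have -> : cos beta = cos (beta / 2 + beta / 2) by rewrite -splitr.
have -> : sin beta = sin (beta / 2 + beta / 2) by rewrite -splitr.
rewrite cosD sinD /tan; have := cos2Dsin2 (beta / 2).
move: (sin (beta / 2)) (cos (beta / 2)) c_gt0 => s c c_gt0 cs.
rewrite -[X in _ = _ - X]mulr1 -cs.
by field; rewrite gt_eqF.
Qed.

(** Up to the foot [lambdaC] the centre lies right of the line to [P_+]. *)
Lemma thetaA_le_thetaB (R : realType) (alpha beta m : R) :
  0 < beta -> beta < alpha -> alpha <= pi -> m <= lambdaC alpha beta ->
  thetaA alpha beta m <= thetaB alpha beta m.
Proof.
move=> b_gt0 ba a_pi mC; apply: le_arccot.
have sideE := side_corner_centre m b_gt0 ba a_pi.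
have side_ge0 : 0 <= (lambdaC alpha beta - m) * sin ((alpha + beta) / 2).
  by rewrite mulr_ge0 ?subr_ge0 // ltW //; apply: sin_gt0_pi; lra.
have A_gt0 : 0 < `|sec_a alpha beta|.
  by rewrite norm_sec_a // divr_gt0 //; apply: sin_gt0_pi; lra.
have l_gt0 : 0 < lN alpha beta by rewrite divr_gt0 //; apply: sin_gt0_pi; lra.
have s_gt0 : 0 < sin (beta / 2) by apply: sin_gt0_pi; lra.
have sb_gt0 : 0 < sin beta by apply: sin_gt0_pi; lra.
rewrite ler_pdivrMr; last exact: mulr_gt0.
rewrite [leRHS]mulrAC ler_pdivlMr; last exact: mulr_gt0.
by move: side_ge0; rewrite -sideE /side; lra.
Qed.

Theorem lemma6p6 (R : realType) (alpha beta : R) (f : R -> R)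
    (u : R * R -> R) (Lambda : R)
    (beta_gt0 : 0 < beta) (beta_lt_alpha : beta < alpha)
    (alpha_le_pi : alpha <= pi)
    (f_lip : locally_lipschitz f)
    (u_sol : is_solution alpha beta f u)
    (Lambda_gt0 : 0 < Lambda) (Lambda_lt : Lambda < lambdaC alpha beta)
    (u_mono : forall lambda theta : R, Lambda <= lambda ->
       (J alpha beta lambda `&` `]0, thetaB alpha beta lambda]) theta ->
       forall p : R * R, (Tline beta lambda theta `&` Sector alpha beta) p ->
         normal_deriv beta theta u p < 0) :
  forall lambda theta : R, Lambda < lambda -> lambda < lambdaC alpha beta ->
    thetaA alpha beta lambda < theta -> theta < thetaB alpha beta lambda ->
    forall p : R * R,
      (Tline beta lambda theta `&`
       right_cap alpha beta Lambda (thetaA alpha beta Lambda)) p ->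
      normal_deriv beta theta u p < 0.
Proof.
move=> lambda theta Ll lC tA tB p [Tp [Sp /= capp]].
have Y_gt0 : 0 < height beta p by apply: height_gt0 Sp; lra.
have theta_gt0 : 0 < theta := lt_trans (arccot_gt0 _) tA.
have theta_ltpi : theta < pi := lt_trans tB (arccot_ltpi _).
have st_gt0 : 0 < sin theta by apply: sin_gt0_pi; rewrite theta_gt0.
have A_gt0 : 0 < `|sec_a alpha beta|.
  by rewrite norm_sec_a // divr_gt0 //; apply: sin_gt0_pi; lra.
have l_gt0 : 0 < lN alpha beta by rewrite divr_gt0 //; apply: sin_gt0_pi; lra.
pose xO := `|sec_a alpha beta| * cos (beta / 2).
pose yO := `|sec_a alpha beta| * sin (beta / 2).
pose xP := lN alpha beta * cos beta.
pose yP := lN alpha beta * sin beta.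
have yO_gt0 : 0 < yO by rewrite mulr_gt0 //; apply: sin_gt0_pi; lra.
have yP_gt0 : 0 < yP by rewrite mulr_gt0 //; apply: sin_gt0_pi; lra.
pose X := along beta p; pose Y := height beta p.
have OLambda : 0 < side xO yO Lambda X Y by rewrite -line_form_arccot_gt0.
have Olambda : side xO yO lambda X Y < 0.
  rewrite -line_form_arccot_lt0 // -(pmulr_llt0 _ st_gt0).
  rewrite (line_form_same_foot _ Tp) pmulr_rlt0 //.
  rewrite -[_ - _]opprB sinN oppr_lt0; apply: sin_gt0_pi.
  by have := arccot_gt0 ((xO - lambda) / yO); move: tA; rewrite /thetaA; lra.
have Plambda : 0 < side xP yP lambda X Y.
  rewrite -line_form_arccot_gt0 // -(pmulr_lgt0 _ st_gt0).
  rewrite (line_form_same_foot _ Tp) pmulr_rgt0 //.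
  apply: sin_gt0_pi.
  by have := arccot_ltpi ((xP - lambda) / yP); move: tB; rewrite /thetaB; lra.
have [m1 /andP[Lm1 m1l] O1] := side_root Ll OLambda Olambda.
(* The side of p seen from O decreases as the foot grows, so it is still
   negative at lambdaC; there the lines from O and from P_+ coincide. *)
have PC : side xP yP (lambdaC alpha beta) X Y < 0.
  have collinear : side xP yP (lambdaC alpha beta) xO yO = 0.
    by rewrite side_corner_centre // subrr mul0r.
  have OC : side xO yO (lambdaC alpha beta) X Y < 0.
    have : 0 < (lambda - Lambda) * (yO - Y).
      by move: OLambda Olambda; rewrite /side; lra.
    rewrite pmulr_rgt0 ?subr_gt0 // => YO.
    have : 0 < (lambdaC alpha beta - lambda) * (yO - Y) by rewrite mulr_gt0 ?subr_gt0.
    by move: Olambda; rewrite /side; lra.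
  rewrite -(pmulr_llt0 _ yO_gt0).
  suff -> : side xP yP (lambdaC alpha beta) X Y * yO =
      side xO yO (lambdaC alpha beta) X Y * yP +
      Y * side xP yP (lambdaC alpha beta) xO yO.
    by rewrite collinear mulr0 addr0 pmulr_llt0.
  rewrite /side; ring.
have [m2 /andP[lm2 m2C] P2] := side_root lC Plambda PC.
have T1 : Tline beta m1 (thetaA alpha beta m1) p by apply: Tline_arccot.
have T2 : Tline beta m2 (thetaB alpha beta m2) p by apply: Tline_arccot.
have sA := sin_arccot_gt0 ((xO - m1) / yO).
have sB := sin_arccot_gt0 ((xP - m2) / yP).
apply: (@normal_deriv_between _ beta (thetaA alpha beta m1) theta
          (thetaB alpha beta m2)).
- exact: sin_angle_gt0 T1 Tp _ _ _ _.
- exact: sin_angle_gt0 Tp T2 _ _ _ _.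
- by apply: sin_angle_gt0 T1 T2 _ _ _ _ => //; apply: lt_trans lm2.
- apply: (u_mono m1) => //; first exact: ltW.
  rewrite /J leNgt (lt_trans m1l lC) /=; split.
    by left; rewrite /= in_itv /= arccot_gt0 lexx.
  rewrite /= in_itv /= arccot_gt0 /= thetaA_le_thetaB // ltW //.
  exact: lt_trans lC.
- apply: (u_mono m2) => //; first by rewrite ltW // (lt_trans Ll).
  rewrite /J leNgt m2C /=; split.
    right; rewrite /= in_itv /= lexx /= thetaB_le //; first by lra.
    by rewrite (le_trans (ltW m2C)) // lambdaC_le_lN.
  by rewrite /= in_itv /= arccot_gt0 lexx.
Qed.
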